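(* Let $\varepsilon>0$, let $\varphi_n$ be the $n$th Hermite function and let $\{\psi_n\}_{n\in\mathbb{Z}_+}$ be the free Schrödinger evolution of $\{\varphi_n\}_{n\in\mathbb{Z}_+}$. Then for all $n\in\mathbb{Z}_+$, $x\in\mathbb{R}$ and $t\ge0$, $$\psi_n(x,t)=\frac{(1+2\mathrm{i}\varepsilon t)^{n/2}}{(1-2\mathrm{i}\varepsilon t)^{(n+1)/2}}\exp\!\left(-\frac{\mathrm{i}t\varepsilon x^2}{1+4\varepsilon^2t^2}\right)\varphi_n\!\left(\frac{x}{(1+4\varepsilon^2t^2)^{1/2}}\right).$$ Moreover, $$|\psi_n(x,t)|\le\frac{1}{[\pi(1+4\varepsilon^2t^2)]^{1/4}},\qquad t\ge0,\ x\in\mathbb{R}.$$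
   Context: $\mathbb{Z}_+=\{0,1,2,\dots\}$. The Hermite functions are $$\varphi_n(x)=\frac{1}{(2^nn!\,\pi^{1/2})^{1/2}}\,H_n(x)\,\mathrm{e}^{-x^2/2},\qquad n\in\mathbb{Z}_+,$$ where $H_n$ is the $n$th (physicists') Hermite polynomial, with generating function $\sum_{n\ge0}H_n(x)z^n/n!=\mathrm{e}^{2xz-z^2}$. The free Schrödinger evolution (FSE) of $\{\varphi_n\}$ is the family $\psi_n$ of solutions of $$\frac{\partial\psi_n}{\partial t}=-\mathrm{i}\varepsilon\frac{\partial^2\psi_n}{\partial x^2},\qquad \psi_n(x,0)=\varphi_n(x),$$ given explicitly by $$\psi_n(x,t)=\frac{1}{\sqrt{2\pi}}\int_{-\infty}^\infty\hat\varphi_n(\eta)\,\mathrm{e}^{\mathrm{i}\eta^2\varepsilon t+\mathrm{i}\eta x}\,\mathrm{d}\eta,\qquad \hat\varphi_n(\eta)=\frac{1}{\sqrt{2\pi}}\int_{-\infty}^\infty\varphi_n(\xi)\,\mathrm{e}^{-\mathrm{i}\eta\xi}\,\mathrm{d}\xi .$$ Complex fractional powers are taken with the principal branch. *)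

(* Defs.v *)
From HB Require Import structures.
From mathcomp Require Import all_boot all_order all_algebra.
From mathcomp Require Import complex.
From mathcomp Require Import all_classical all_reals all_analysis.
From mathcomp Require Import ring lra.

Set Implicit Arguments.
Unset Strict Implicit.
Unset Printing Implicit Defensive.

Import Order.TTheory GRing.Theory Num.Theory.
Import numFieldNormedType.Exports.

Local Open Scope classical_set_scope.
Local Open Scope ring_scope.
Local Open Scope complex_scope.

Definition cexp (R : realType) (z : R[i]) : R[i] :=
  (expR (complex.Re z))%:C * (cos (complex.Im z) +i* sin (complex.Im z)).

(* Principal argument, with values in ]-pi, pi] for z != 0. *)
Definition carg (R : realType) (z : R[i]) : R :=
  let a := acos (complex.Re z / complex.Re `|z|) in
  if 0 <= complex.Im z then a else - a.

(* Principal logarithm, meaningful for z != 0. *)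
Definition clog (R : realType) (z : R[i]) : R[i] :=
  ln (complex.Re `|z|) +i* carg z.

(* Principal branch of z ^ a for a real exponent a, with 0 ^ a = (a == 0). *)
Definition cpow (R : realType) (z : R[i]) (a : R) : R[i] :=
  if z == 0 then (a == 0)%:R else cexp (a%:C * clog z).

Definition cintegral (R : realType) (f : R -> R[i]) : R[i] :=
  (\int[lebesgue_measure]_(x in setT) complex.Re (f x)) +i*
  (\int[lebesgue_measure]_(x in setT) complex.Im (f x)).

(* Physicists' normalization; see hermite_generating. *)
Fixpoint hermite (R : realType) (n : nat) : {poly R} :=
  if n is m.+1 then 2 *: ('X * hermite R m) - (hermite R m)^`() else 1.

Definition hermite_fun (R : realType) (n : nat) (x : R) : R :=
  (Num.sqrt (2 ^+ n * n`!%:R * Num.sqrt pi))^-1 * (hermite R n).[x]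
  * expR (- (x ^+ 2 / 2)).

Definition fourier (R : realType) (f : R -> R[i]) (eta : R) : R[i] :=
  ((Num.sqrt (2 * pi))^-1)%:C *
  cintegral (fun xi => f xi * cexp (- (eta * xi)*i)).

(* Free evolution d_t psi = - i eps d_xx psi with psi(., 0) = f, through its
   Fourier representation. *)
Definition free_schrodinger (R : realType) (eps : R) (f : R -> R[i])
    (x t : R) : R[i] :=
  ((Num.sqrt (2 * pi))^-1)%:C *
  cintegral (fun eta => fourier f eta *
    cexp ((eta ^+ 2 * eps * t)*i + (eta * x)*i)).

Definition hermite_evolution (R : realType) (eps : R) (n : nat) (x t : R) :=
  free_schrodinger eps (fun y => (hermite_fun n y)%:C) x t.

Section HermiteGenerating.
Variable R : realType.

Lemma deriv_hermite n :
  (hermite R n.+1)^`() = (2 * n.+1%:R) *: hermite R n.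
Proof.
elim: n => [|n IHn].
  by rewrite /= -polyC1 derivC mulr1 subr0 derivZ derivX mulr1.
rewrite [hermite R n.+2]/= -/(hermite R n.+1).
rewrite derivB derivZ derivM derivX mul1r IHn.
rewrite derivZ -scalerAr scalerDr -[LHS]addrA.
rewrite [X in _ + X](_ : _ = (2 * n.+1%:R) *: hermite R n.+1); last first.
  rewrite /= scalerBr; congr (_ - _).
  by rewrite !scalerA mulrC.
by rewrite -scalerDl -[2 in X in X + _]mulr1 -mulrDr nat1r.
Qed.

Lemma hermiteSS n (x : R) : (hermite R n.+2).[x] =
  2 * x * (hermite R n.+1).[x] - 2 * n.+1%:R * (hermite R n).[x].
Proof.
rewrite [hermite R n.+2]/= -/(hermite R n.+1) deriv_hermite.
by rewrite hornerD hornerN !hornerZ hornerM hornerX mulrA.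
Qed.

Let a (x : R) n := (hermite R n).[x] / n`!%:R.

Let a0 x : a x 0%N = 1.
Proof. by rewrite /a /= hornerC fact0 divr1. Qed.

Let a1 x : a x 1%N = 2 * x.
Proof. by rewrite /a /= -polyC1 derivC subr0 mulr1 hornerZ hornerX divr1. Qed.

Let aS x n : n.+2%:R * a x n.+2 = 2 * x * a x n.+1 - 2 * a x n.
Proof.
rewrite /a hermiteSS.
rewrite (factS n.+1) natrM invfM mulrCA mulVKf ?pnatr_eq0//.
rewrite mulrBl -!mulrA; congr (_ - _); congr (_ * _).
by rewrite mulrCA factS natrM invfM mulVKf ?pnatr_eq0.
Qed.

Let entire (c : nat -> R) :=
  forall r : R, 0 < r -> exists K, forall n, `|c n * r ^+ n| <= K.

Let a_entire x : entire (a x).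
Proof.
move=> r r0.
pose c := 2 * `|x| * r + 2 * r ^+ 2.
have c0 : 0 <= c by rewrite addr_ge0// !mulr_ge0// ?sqr_ge0// ltW.
pose b n := `|a x n * r ^+ n|.
have bS n : n.+2%:R * b n.+2 <= 2 * `|x| * r * b n.+1 + 2 * r ^+ 2 * b n.
  rewrite /b -{1}(ger0_norm (ler0n R n.+2)) -normrM mulrA aS mulrBl.
  apply: le_trans (ler_normB _ _) _.
  rewrite !normrM !normrX (ger0_norm (ltW r0)) (ger0_norm (ler0n R 2)).
  by rewrite !exprS expr0 mulr1; rewrite le_eqVlt; apply/orP; left; apply/eqP; ring.
pose N := Num.truncn c.
have cN n : (N <= n)%N -> c <= n.+2%:R.
  move=> Nn; apply: ltW; apply: lt_le_trans (truncnS_gt c) _.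
  by rewrite ler_nat ltnS; apply: leq_trans Nn _.
pose K := \sum_(i < N.+2) b i.
have Kb i : (i < N.+2)%N -> b i <= K.
  move=> iN; rewrite /K (bigD1 (Ordinal iN))//= lerDl.
  by apply: sumr_ge0 => j _; rewrite normr_ge0.
have H n : b n <= K /\ b n.+1 <= K.
  elim: n => [|n [IH1 IH2]]; first by split; apply: Kb.
  split=> //; have [nN|Nn] := ltnP n N; first by apply: Kb.
  have K0 : 0 <= K by apply: le_trans IH1; rewrite normr_ge0.
  rewrite -(@ler_pM2l _ n.+2%:R)// (le_trans (bS n))//.
  apply: (@le_trans _ _ (c * K)).
    by rewrite /c [leRHS]mulrDl lerD// ler_wpM2l// !mulr_ge0// ?sqr_ge0// ltW.
  by rewrite ler_wpM2r// cN.
by exists K => n; have [] := H n.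
Qed.

Let diffs_entire c : entire c -> entire (pseries_diffs c).
Proof.
move=> ec r r0; have [|K HK] := ec (2 * r); first by rewrite mulr_gt0.
exists (K / r) => n; rewrite ler_pdivlMr//.
apply: le_trans (HK n.+1).
rewrite -{2}(gtr0_norm r0) -normrM /pseries_diffs.
rewrite (_ : _ * _ * _ * _ = n.+1%:R * (c n.+1 * r ^+ n.+1)); last first.
  by rewrite exprSr; ring.
rewrite exprMn [in leRHS]mulrCA normrM [leRHS]normrM.
by rewrite ler_wpM2r// -natrX !ger0_norm// ler_nat ltnW// ltn_expl.
Qed.

Let cvg_entire c z : entire c -> cvgn (pseries c z).
Proof.
move=> ec; have [|K HK] := ec (`|z| + 1); first by rewrite ltr_wpDl.
apply: (@is_cvg_pseries_inside _ _ (`|z| + 1 / 2)).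
  apply: normed_cvg.
  have K0 : 0 <= K by apply: le_trans (HK 0%N).
  pose q := (`|z| + 1 / 2) / (`|z| + 1).
  have z0 := normr_ge0 z.
  have q0 : 0 <= q by rewrite divr_ge0//; lra.
  have q1 : q < 1 by rewrite ltr_pdivrMr; lra.
  apply: (@series_le_cvg _ _ (geometric K q)) => [n|n|n|] /=.
  - by [].
  - by rewrite mulr_ge0// exprn_ge0.
  - rewrite (_ : _ * _ = c n * (`|z| + 1) ^+ n * q ^+ n); last first.
      by rewrite -mulrA -exprMn mulrC -/q mulrCA divff ?mulr1//; lra.
    by rewrite normrM normrX (ger0_norm q0) ler_wpM2r// exprn_ge0.
  - by apply: is_cvg_geometric_series; rewrite ger0_norm.
by rewrite (ger0_norm (_ : 0 <= `|z| + 1 / 2)) ?ltrDl//; have := normr_ge0 z; lra.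
Qed.

Let diffs_lim x z : limn (pseries (pseries_diffs (a x)) z) =
  (2 * x - 2 * z) * limn (pseries (a x) z).
Proof.
apply/cvg_lim => //; rewrite -cvg_shiftS.
have cz := @cvg_entire _ z (a_entire x).
rewrite (_ : [sequence _]_n = fun n =>
    2 * x * pseries (a x) z n.+1 - 2 * z * pseries (a x) z n).
  rewrite mulrBl; apply: cvgB; apply: cvgMl_tmp => //.
  by rewrite (cvg_shiftS (pseries (a x) z)).
apply/funext => n; rewrite /pseries /series/=.
rewrite !big_nat_recl//= a0 /pseries_diffs a1 !expr0 !mulr1 mul1r mulrDr mulr1.
rewrite -[RHS]addrA; congr (_ + _).
rewrite !mulr_sumr -sumrB; apply: eq_bigr => i _.
by rewrite aS exprS; ring.
Qed.

Lemma hermite_generating (x z : R) :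
  [series (hermite R n).[x] * z ^+ n / n`!%:R]_n @ \oo -->
  expR (2 * x * z - z ^+ 2).
Proof.
pose f z := limn (pseries (a x) z).
have df y : is_derive y (1 : R) f ((2 * x - 2 * y) * f y).
  rewrite /f -diffs_lim; apply: (@pseries_snd_diffs _ _ (`|y| + 1)).
  - exact/cvg_entire/a_entire.
  - exact/cvg_entire/diffs_entire/a_entire.
  - exact/cvg_entire/diffs_entire/diffs_entire/a_entire.
  - by rewrite (ger0_norm (_ : 0 <= `|y| + 1)) ?ltrDl// addr_ge0.
pose g y := f y * expR (y ^+ 2 - 2 * x * y).
have gE : g z = g 0.
  apply: is_derive_0_is_cst => y.
  rewrite /g; apply: is_derive_eq.
  by rewrite /GRing.scale/=; ring.
have f0 : f 0 = 1.
  apply/cvg_lim => //; rewrite -cvg_shiftS /=.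
  apply: cvg_near_cst; apply: nearW => n.
  rewrite /pseries /series/= big_nat_recl//= a0 expr0 mulr1 big1 ?addr0//.
  by move=> i _; rewrite exprS mul0r mulr0.
have g1 : f z * expR (z ^+ 2 - 2 * x * z) = 1.
  by rewrite -/(g z) gE /g f0 expr0n mulr0 subr0 expR0 mul1r.
have fE : f z = expR (2 * x * z - z ^+ 2).
  apply: (mulIf (lt0r_neq0 (expR_gt0 (z ^+ 2 - 2 * x * z)))).
  by rewrite g1 -expRD -opprB addNr expR0.
rewrite -fE (_ : [series _]_n = pseries (a x) z).
  exact: (@cvg_entire _ z (a_entire x)).
by apply/funext => n; apply: eq_bigr => i _; rewrite /= /a mulrAC.
Qed.

End HermiteGenerating.

(* Main.v *)
Require Import Defs.
From mathcomp Require Import all_boot all_order all_algebra.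
From mathcomp Require Import complex.
From mathcomp Require Import all_classical all_reals all_analysis.
From mathcomp Require Import measurable_realfun.
From mathcomp Require Import ring lra.

Import Order.TTheory GRing.Theory Num.Theory.
Import numFieldNormedType.Exports.

Local Open Scope classical_set_scope.
Local Open Scope ring_scope.
Local Open Scope complex_scope.

(** The Fourier transform of a Hermite function and the evolution itself are both
    integrals over the line of a Hermite polynomial against a Gaussian chirp
    [exp (- a y ^ 2 / 2 + i c y)], with [a = 1] and [a = 1 - 2 i eps t]
    respectively. For [n = 0] this is a complex Gaussian integral (moment_one),
    computed by differentiating along a segment of parameters that starts at the
    real Gaussian integral. For larger [n], integration by parts gives
    a three-term recurrence of the same shape as the one for Hermite polynomials,
    with the argument rescaled by [|a|] and each step rotated by
    [pi / 2 + arg (conj a)] (moment_hermite). Applied once it shows that Hermite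
    functions are eigenfunctions of the Fourier transform (fourier_hermite), applied
    a second time it gives the evolution in polar form (hermite_evolution_polar);
    principal powers of a number in the right half plane are then read off from
    its modulus and its arctangent (cpow_right).

    The modulus of the evolution is [(1 + 4 eps ^ 2 t ^ 2) ^ (- 1 / 4)] times
    a value of the Hermite function [phi_n], so the bound amounts to
    [|phi_n| <= pi ^ (- 1 / 4)], the maximum of [phi_0] (hermite_fun_sup). This goes by
    induction on [n]. With [D t = 2 (n + 1) - t ^ 2], the two Sonin functions
    [phi_(n+1) ^ 2 + phi_(n+1)' ^ 2 / D] and [phi_n ^ 2 + phi_n' ^ 2 / D] coincide, and
    the derivative of their common value is a positive multiple of
    [phi_(n+1)' phi_n']. Moving left from the point where [|phi_(n+1)|] is largest,
    this function first increases and reaches its maximum at a critical point of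
    [phi_(n+1)], which is impossible, or of [phi_n], where its value
    is bounded by induction (hermite_fun_sup_step). *)

(** * Polynomials against the Gaussian weight *)

Section GaussianWeight.
Context {R : realType}.
Implicit Types (P : {poly R}) (x y : R).
Local Notation mu := (@lebesgue_measure R).

Lemma is_derive_continuous (f f' : R -> R) :
  (forall x, is_derive x (1 : R) f (f' x)) -> continuous f.
Proof.
move=> df x; apply/differentiable_continuous/derivable1_diffP.
by have [] := df x.
Qed.

(** For a monomial this is [x ^ (2 k + 2) / (4 ^ (k + 1) (k + 1)!) <= expR (x ^ 2 / 4)],
    one term of the exponential series. The general case is proved together with
    all its multiples by powers of [x]: in the step from [P] to [P * 'X + c], the
    factor ['X] raises that power and the constant is covered by the monomials. *)
Lemma poly_gauss_bounded P :
  exists2 C, 0 <= C & forall x, `|P.[x]| * expR (- (x ^+ 2 / 4)) <= C.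
Proof.
have monom k : exists2 C, 0 <= C &
    forall x, `|x| ^+ k * expR (- (x ^+ 2 / 4)) <= C.
  exists (1 + 4 ^+ k.+1 * k.+1`!%:R); first by rewrite addr_ge0// mulr_ge0// exprn_ge0.
  move=> x; rewrite expRN ler_pdivrMr ?expR_gt0//.
  have x40 : 0 <= x ^+ 2 / 4 by rewrite divr_ge0// sqr_ge0.
  have := @expR_ge1Dxn R _ k x40; set E := expR _ => hE.
  have E1 : 1 <= E by rewrite (le_trans _ hE)// lerDl divr_ge0// exprn_ge0.
  have xk : `|x| ^+ k <= 1 + (x ^+ 2) ^+ k.+1.
    have [x1|x1] := lerP `|x| 1.
      apply: (@le_trans _ _ 1); first by rewrite exprn_ile1.
      by rewrite lerDl exprn_ge0// sqr_ge0.
    rewrite -real_normK ?num_real// -exprM.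
    rewrite (@le_trans _ _ (`|x| ^+ (2 * k.+1)))//; last by rewrite lerDr.
    by rewrite ler_weXn2l ?ltW// mul2n -addnn (leq_trans (leqnSn k))// leq_addr.
  rewrite (le_trans xk)// mulrDl mul1r lerD//.
  rewrite (_ : _ ^+ _ = 4 ^+ k.+1 * k.+1`!%:R *
      ((x ^+ 2 / 4) ^+ k.+1 / k.+1`!%:R)); last first.
    rewrite expr_div_n; field.
    by rewrite expf_neq0//= pnatr_eq0 -lt0n fact_gt0.
  rewrite ler_wpM2l// ?mulr_ge0 ?exprn_ge0//.
  by rewrite (le_trans _ hE)// lerDr.
have bound k : exists2 C, 0 <= C &
    forall x, `|P.[x]| * (`|x| ^+ k * expR (- (x ^+ 2 / 4))) <= C.
  elim/poly_ind: P k => [|P c IH] k.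
    by exists 0 => // x; rewrite horner0 normr0 mul0r.
  have [C C0 HC] := IH k.+1; have [D D0 HD] := monom k.
  exists (C + `|c| * D) => [|x]; first by rewrite addr_ge0// mulr_ge0.
  rewrite hornerMXaddC.
  have w0 : 0 <= `|x| ^+ k * expR (- (x ^+ 2 / 4)).
    by rewrite mulr_ge0 ?expR_ge0// exprn_ge0.
  rewrite (le_trans (ler_wpM2r w0 (ler_normD _ _)))//.
  rewrite mulrDl lerD//; last by rewrite ler_wpM2l.
  by rewrite normrM (le_trans _ (HC x))// (exprS `|x|) !mulrA.
by have [C C0 HC] := bound 0%N; exists C => // x; have := HC x; rewrite expr0 mul1r.
Qed.

Lemma integrable_gauss4 :
  mu.-integrable setT (EFin \o (fun x => expR (- (x ^+ 2 / 4)))).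
Proof.
have s0 : Num.sqrt 2 != 0 :> R by rewrite gt_eqF// sqrtr_gt0.
have := @integrable_normal_pdf R 0 (Num.sqrt 2).
move=> /(integrableZl measurableT (normal_peak (Num.sqrt (2:R)))^-1).
apply: eq_integrable => // x _.
rewrite -EFinM normal_pdfE// mulKf ?gt_eqF ?normal_peak_gt0//.
rewrite /normal_fun subr0 sqr_sqrtr//; congr (expR _)%:E.
by rewrite mulNr; congr (- (_ / _)); rewrite -mulr_natr; lra.
Qed.

(** Half of the Gaussian weight absorbs the polynomial; the other half stays as
    an integrable envelope that tends to 0, which serves both as a domination
    for integrals and as a bound for boundary terms. *)
Lemma poly_gauss_le P : exists2 C, 0 <= C &
  forall x, `|P.[x]| * expR (- (x ^+ 2 / 2)) <= C * expR (- (x ^+ 2 / 4)).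
Proof.
have [C C0 HC] := poly_gauss_bounded P; exists C => // x.
rewrite (_ : x ^+ 2 / 2 = x ^+ 2 / 4 + x ^+ 2 / 4); last lra.
by rewrite opprD expRD mulrA ler_wpM2r// expR_ge0.
Qed.

Lemma integrable_poly_gauss_dominated P (f : R -> R) : measurable_fun setT f ->
  (forall x, `|f x| <= `|P.[x]| * expR (- (x ^+ 2 / 2))) ->
  mu.-integrable setT (EFin \o f).
Proof.
move=> mf fP; have [C C0 HC] := poly_gauss_le P.
have := integrableZl measurableT C integrable_gauss4.
apply: le_integrable => //; first exact/measurable_EFinP.
move=> x _ /=; rewrite lee_fin (le_trans (fP x))// (le_trans (HC x))//.
by rewrite ger0_norm// mulr_ge0// expR_ge0.
Qed.

Lemma cvg_poly_gauss_dominated P (f : R -> R) (u : nat -> R) :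
  (forall x, `|f x| <= `|P.[x]| * expR (- (x ^+ 2 / 2))) ->
  (forall n, n%:R <= `|u n|) ->
  f (u n) @[n --> \oo] --> (0 : R).
Proof.
move=> fP nu; have [C C0 HC] := poly_gauss_le P.
have h0 : C * expR 1 * expR (- n%:R) @[n --> \oo] --> (0 : R).
  have := cvgMl_tmp (a := C * expR 1) (@cvgn_expR R); rewrite mulr0; exact.
apply/norm_cvg0P; apply: (squeeze_cvgr _ (cvg_cst 0) h0).
near=> n; rewrite normr_ge0/= (le_trans (fP _))// (le_trans (HC _))//.
rewrite -mulrA -expRD ler_wpM2l// ler_expR -real_normK ?num_real//.
(* [- (v ^ 2 / 4) <= 1 - v] says that [(v / 2 - 1) ^ 2] is nonnegative. *)
have := nu n; have := sqr_ge0 (`|u n| / 2 - 1).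
by move: (n%:R) `|u n| => a b; rewrite !expr2; lra.
Unshelve. all: by end_near. Qed.

(** Fundamental theorem of calculus on [[-n, n]], then dominated convergence; this
    is what turns integration by parts on the line into an identity without
    boundary terms. *)
Lemma integral_derivative_eq0 (F f : R -> R) :
  (forall x, is_derive x (1 : R) F (f x)) -> continuous f ->
  mu.-integrable setT (EFin \o f) ->
  (forall u : nat -> R, (forall n, n%:R <= `|u n|) ->
     F (u n) @[n --> \oo] --> (0 : R)) ->
  \int[mu]_(x in setT) f x = 0.
Proof.
move=> dF cf intf F0.
have mf : measurable_fun setT f by exact: continuous_measurable_fun.
pose I n := `[(- n.+1%:R : R), n.+1%:R]%classic.
have [|||||_ _ h] := @dominated_convergence _ _ _ mu setT measurableT
  (fun n => (EFin \o f) \_ (I n)) (EFin \o f) (fun x => `|f x|%:E).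
- move=> n; apply/(measurable_restrictT _ _).1; first exact: measurable_itv.
  by apply/measurable_EFinP; exact: measurable_funTS.
- exact/measurable_EFinP.
- apply: aeW => x _; apply: cvg_near_cst; near=> n.
  rewrite patchE ifT// inE /I/= in_itv/= -ler_norml.
  near: n; exists (Num.truncn `|x|) => // n /= hn.
  by rewrite ltW// (lt_le_trans (truncnS_gt _))// ler_nat ltnS.
- exact: integrable_abse intf.
- apply: aeW => x n _; rewrite patchE; case: ifPn => //= _.
  by rewrite normr0 lee_fin.
move: h.
have -> : (fun n => (\int[mu]_x ((EFin \o f) \_ (I n)) x)%E) =
    (fun n => (F n.+1%:R - F (- n.+1%:R))%:E).
  apply/funext => n; rewrite -integral_mkcond.
  rewrite (@continuous_FTC2 _ f F (- n.+1%:R) n.+1%:R)//.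
  - by rewrite (@lt_trans _ _ 0)// oppr_lt0.
  - by apply: continuous_subspaceT.
  - split.
    + by move=> x _; apply: ex_derive.
    + apply: cvg_at_right_filter.
      exact/differentiable_continuous/derivable1_diffP/ex_derive.
    + apply: cvg_at_left_filter.
      exact/differentiable_continuous/derivable1_diffP/ex_derive.
  - by move=> x _; rewrite derive1E derive_val.
have Flim : F n.+1%:R - F (- n.+1%:R) @[n --> \oo] --> (0 : R).
  rewrite -(subrr (0:R)); apply: cvgB; apply: F0 => n.
    by rewrite ger0_norm// ler_nat.
  by rewrite normrN ger0_norm// ler_nat.
move=> h; rewrite /Rintegral.
have h' : (F n.+1%:R - F (- n.+1%:R))%:E @[n --> \oo] --> 0%:E.
  by apply: cvg_EFin; [exact: nearW|exact: Flim].
by rewrite (cvg_unique _ h h').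
Unshelve. all: by end_near. Qed.

End GaussianWeight.

(** * Moments of Gaussian chirps *)

Section ChirpMoments.
Context {R : realType}.
Implicit Types (P Q : {poly R}) (b c d s x y : R).
Local Notation mu := (@lebesgue_measure R).

(** The real part of [e ^ (i d)] times the Gaussian chirp
    [exp (- a y ^ 2 / 2 + i c y)] with [a = 1 - 2 i b]. Keeping the phase [d] as a
    parameter makes one real family carry the whole complex function: [d - pi / 2]
    gives the imaginary part, and multiplication by [i] is the shift
    [d |-> d + pi / 2]. *)
Definition wave b c d y := expR (- (y ^+ 2 / 2)) * cos (b * y ^+ 2 + c * y + d).

Definition moment b c d P := \int[mu]_(y in setT) (P.[y] * wave b c d y).

Lemma is_derive_poly_wave P b c d y :
  is_derive y (1 : R) (fun y => P.[y] * wave b c d y)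
    ((P^`() - 'X * P).[y] * wave b c d y +
     (((2 * b) *: 'X + c%:P) * P).[y] * wave b c (d + pi / 2) y).
Proof.
rewrite /wave addrA cosDpihalf; apply: is_derive_eq.
by rewrite /GRing.scale/= !(hornerD, hornerN, hornerM, hornerZ, hornerX, hornerC); field.
Qed.

Lemma continuous_poly_wave P b c d : continuous (fun y => P.[y] * wave b c d y).
Proof.
exact: is_derive_continuous (is_derive_poly_wave P b c d).
Qed.

Lemma norm_poly_wave P b c d y :
  `|P.[y] * wave b c d y| <= `|P.[y]| * expR (- (y ^+ 2 / 2)).
Proof.
rewrite normrM ler_wpM2l// normrM ger0_norm ?expR_ge0//.
by rewrite ler_piMr ?expR_ge0// ler_norml cos_geN1 cos_le1.
Qed.

Lemma integrable_poly_wave P b c d :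
  mu.-integrable setT (EFin \o (fun y => P.[y] * wave b c d y)).
Proof.
apply: (integrable_poly_gauss_dominated P); last exact: norm_poly_wave.
by apply: continuous_measurable_fun; exact: continuous_poly_wave.
Qed.

Lemma momentD b c d P Q : moment b c d (P + Q) = moment b c d P + moment b c d Q.
Proof.
rewrite /moment -RintegralD//; [|exact: integrable_poly_wave..].
by apply: eq_Rintegral => y _; rewrite hornerD mulrDl.
Qed.

Lemma momentZ b c d k P : moment b c d (k *: P) = k * moment b c d P.
Proof.
rewrite /moment -RintegralZl//; last exact: integrable_poly_wave.
by apply: eq_Rintegral => y _; rewrite hornerZ -mulrA.
Qed.

Lemma moment0 b c d : moment b c d 0 = 0.
Proof.
by rewrite -[X in moment _ _ _ X](scale0r (0 : {poly R})) momentZ mul0r.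
Qed.

Lemma momentB b c d P Q : moment b c d (P - Q) = moment b c d P - moment b c d Q.
Proof. by rewrite momentD -scaleN1r momentZ mulN1r. Qed.

Lemma moment_phase b c d P :
  moment b c d P = cos d * moment b c 0 P + sin d * moment b c (pi / 2) P.
Proof.
rewrite -!momentZ /moment -RintegralD//; [|exact: integrable_poly_wave..].
apply: eq_Rintegral => y _.
by rewrite !hornerZ /wave addr0 cosDpihalf cosD; ring.
Qed.

Lemma momentDpi b c d P : moment b c (d + pi / 2 + pi / 2) P = - moment b c d P.
Proof.
rewrite moment_phase [moment b c d P]moment_phase.
by rewrite cosDpihalf !sinDpihalf cosDpihalf; ring.
Qed.

Lemma moment_ibp b c d P :
  moment b c d P^`() - moment b c d ('X * P)
  + 2 * b * moment b c (d + pi / 2) ('X * P)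
  + c * moment b c (d + pi / 2) P = 0.
Proof.
rewrite -addrA -!momentZ -momentB -momentD scalerAl -mul_polyC -mulrDl.
rewrite /moment -RintegralD//; [|exact: integrable_poly_wave..].
apply: (@integral_derivative_eq0 _ (fun y => P.[y] * wave b c d y)).
- by move=> y; apply: is_derive_poly_wave.
- by move=> y; apply: cvgD; exact: continuous_poly_wave.
- apply: eq_integrable (integrableD measurableT (integrable_poly_wave _ _ _ _)
    (integrable_poly_wave _ _ _ _)) => //.
- move=> u; apply: (cvg_poly_gauss_dominated P (fun y => P.[y] * wave b c d y)).
  exact: norm_poly_wave.
Qed.

(** Integration by parts determines [a] times the moment of ['X * P]; since
    division by [a] mixes the phases [d] and [d + pi / 2], the relation is used at
    both of them and the resulting two by two system, of determinant
    [1 + 4 * b ^+ 2], is solved. *)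
Lemma momentX b c d P : moment b c d ('X * P) =
  (moment b c d P^`() + c * moment b c (d + pi / 2) P
   + 2 * b * (moment b c (d + pi / 2) P^`() - c * moment b c d P))
  / (1 + 4 * b ^+ 2).
Proof.
have r0 : 1 + 4 * b ^+ 2 != 0 by rewrite gt_eqF// ltr_wpDr// mulr_ge0// sqr_ge0.
have := moment_ibp b c (d + pi / 2) P; have := moment_ibp b c d P.
rewrite !momentDpi => h1 h2; apply: (mulIf r0); rewrite mulfVK//.
set u := moment b c d ('X * P) in h1 h2 *.
set v := moment b c (d + pi / 2) ('X * P) in h1 h2 *.
set p := moment b c d P in h1 h2 *.
set q := moment b c (d + pi / 2) P in h1 h2 *.
set p' := moment b c d P^`() in h1 h2 *.
set q' := moment b c (d + pi / 2) P^`() in h1 h2 *.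
apply/eqP; rewrite -subr_eq0; apply/eqP.
transitivity (- ((p' - u + 2 * b * v + c * q)
  + 2 * b * (q' - v + 2 * b * (- u) + c * (- p)))); first by ring.
by rewrite h1 h2; ring.
Qed.

(** Total mass of the standard normal density. *)
Lemma moment_gauss : moment 0 0 0 1 = Num.sqrt (2 * pi).
Proof.
have sp : 0 < Num.sqrt (2 * pi : R) by rewrite sqrtr_gt0 mulr_gt0// pi_gt0.
have := @integral_normal_pdf R 0 1.
rewrite (_ : (fun x => _) =
  (fun x => ((Num.sqrt (2 * pi))^-1 * ((1 : {poly R}).[x] * wave 0 0 0 x))%:E)).
  move=> h; rewrite -[RHS]mulr1 -[X in _ * X]/(fine 1%:E) -h.
  rewrite -/(Rintegral mu setT _) RintegralZl//; last exact: integrable_poly_wave.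
  by rewrite mulVKf// gt_eqF.
apply/funext => x; rewrite normal_pdfE ?oner_neq0// /normal_peak /normal_fun /wave.
rewrite hornerC !mul0r !addr0 cos0 mulr1 mul1r expr1n mul1r subr0 mulr_natl.
by rewrite mulr2n mulNr.
Qed.

End ChirpMoments.

(** * The complex Gaussian integral *)

Section ChirpGaussian.
Context {R : realType}.
Implicit Types (P Q : {poly R}) (b c d s x y : R).
Local Notation mu := (@lebesgue_measure R).

(** Differentiation under the integral sign: the derivative in [s] of the integrand
    is dominated, uniformly in [s], by a polynomial times the Gaussian weight. *)
Lemma is_derive_moment_scale b c d s :
  is_derive s (1 : R) (fun s => moment (s * b) (s * c) d 1)
    (moment (s * b) (s * c) (d + pi / 2) ('X * (b *: 'X + c%:P))).
Proof.
pose Q := 'X * (b *: 'X + c%:P).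
pose f r y := (1 : {poly R}).[y] * wave (r * b) (r * c) d y.
have df r y : is_derive r (1 : R) (f ^~ y)
    (Q.[y] * wave (r * b) (r * c) (d + pi / 2) y).
  rewrite /f /wave /Q addrA cosDpihalf; apply: is_derive_eq.
  rewrite /GRing.scale/= !(hornerD, hornerN, hornerM, hornerZ, hornerX, hornerC).
  by rewrite /GRing.scale/=; field.
pose G y := `|Q.[y] * wave 0 0 0 y|.
have G0 y : 0 <= G y by rewrite normr_ge0.
have intG : mu.-integrable setT (EFin \o G).
  exact: integrable_abse (integrable_poly_wave Q 0 0 0).
have GE y : G y = `|Q.[y]| * expR (- (y ^+ 2 / 2)).
  rewrite /G /wave !mul0r !addr0 cos0 mulr1 normrM; congr (_ * _).
  by rewrite ger0_norm ?expR_ge0.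
have d1E r y : partial1of2 f r y = Q.[y] * wave (r * b) (r * c) (d + pi / 2) y.
  by rewrite /partial1of2 derive1E derive_val.
have Is : `]s - 1, s + 1[%classic s by rewrite /= in_itv/= ltrBlDr ltrDl ltr01.
have h1 r : `]s - 1, s + 1[%classic r -> mu.-integrable setT (EFin \o f r).
  by move=> _; exact: integrable_poly_wave.
have h2 r y : `]s - 1, s + 1[%classic r -> setT y -> derivable (f ^~ y) r 1.
  by move=> _ _; have [] := df r y.
have h3 r y : `]s - 1, s + 1[%classic r -> setT y -> `|partial1of2 f r y| <= G y.
  by move=> _ _; rewrite d1E GE; exact: norm_poly_wave.
apply: DeriveDef; first exact: (derivable_under_integral measurableT Is h1 h2 G0 intG h3).
rewrite -derive1E (differentiation_under_integral measurableT Is h1 h2 G0 intG h3).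
by apply: eq_Rintegral => y _; rewrite d1E.
Qed.

(** Argument and, in the next definition, modulus of
    [a ^ (- 1 / 2) * exp (- c ^ 2 / (2 a))], where [a = 1 - 2 i b]. *)
Definition chirp_phase b c := atan (2 * b) / 2 - b * c ^+ 2 / (1 + 4 * b ^+ 2).

Definition chirp_decay b c :=
  expR (- (ln (1 + 4 * b ^+ 2) / 4 + c ^+ 2 / (2 * (1 + 4 * b ^+ 2)))).

(** Complex Gaussian integral. Along the segment from [(0, 0)] to [(b, c)] the
    integral [K s] of the chirp with parameters [(s * b, s * c)] solves a scalar
    linear equation, whose coefficient is found by reducing the moments of ['X] and
    ['X ^ 2] to [K s]. Hence [K s] divided by the expected value is constant,
    and at [s = 0] it is the real Gaussian integral. *)
Lemma moment_one b c d : moment b c d 1 =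
  Num.sqrt (2 * pi) * chirp_decay b c * cos (d + chirp_phase b c).
Proof.
pose K1 s := moment (s * b) (s * c) 0 1.
pose K2 s := moment (s * b) (s * c) (pi / 2) 1.
pose Q s := 1 + 4 * (s * b) ^+ 2.
have Q0 s : 0 < Q s by rewrite /Q ltr_wpDr// mulr_ge0// sqr_ge0.
(* First and second moments in terms of [K1] and [K2], from momentX. *)
pose X1 s := s * c * (K2 s - 2 * (s * b) * K1 s) / Q s.
pose X2 s := s * c * (- K1 s - 2 * (s * b) * K2 s) / Q s.
pose Y1 s := (K1 s + s * c * X2 s + 2 * (s * b) * (K2 s - s * c * X1 s)) / Q s.
pose Y2 s := (K2 s - s * c * X1 s - 2 * (s * b) * (K1 s + s * c * X2 s)) / Q s.
have deriv1 : (1 : {poly R})^`() = 0 by rewrite -polyC1 derivC.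
have mpi b' c' P : moment b' c' (pi / 2 + pi / 2) P = - moment b' c' 0 P.
  by have := momentDpi b' c' 0 P; rewrite add0r.
have X1E s : moment (s * b) (s * c) 0 'X = X1 s.
  rewrite -['X]mulr1 momentX deriv1 !moment0 !add0r /X1 /K1 /K2.
  by congr (_ / _); ring.
have X2E s : moment (s * b) (s * c) (pi / 2) 'X = X2 s.
  rewrite -['X]mulr1 momentX deriv1 !moment0 mpi /X2 /K1 /K2.
  by congr (_ / _); ring.
have Y1E s : moment (s * b) (s * c) 0 ('X * 'X) = Y1 s.
  by rewrite momentX derivX !add0r X1E X2E.
have Y2E s : moment (s * b) (s * c) (pi / 2) ('X * 'X) = Y2 s.
  rewrite momentX derivX !mpi X1E X2E /Y2 /K1 /K2.
  by congr (_ / _); ring.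
have dQ d' s : moment (s * b) (s * c) d' ('X * (b *: 'X + c%:P)) =
    b * moment (s * b) (s * c) d' ('X * 'X) + c * moment (s * b) (s * c) d' 'X.
  rewrite -!momentZ -momentD; congr (moment _ _ _ _).
  by rewrite -!mul_polyC; ring.
have dK1 s : is_derive s (1 : R) K1 (b * Y2 s + c * X2 s).
  by rewrite -Y2E -X2E -dQ; have := is_derive_moment_scale b c 0 s; rewrite add0r.
have dK2 s : is_derive s (1 : R) K2 (- (b * Y1 s + c * X1 s)).
  rewrite -Y1E -X1E -dQ -mpi; exact: is_derive_moment_scale.
pose g s := chirp_phase (s * b) (s * c).
pose B s := expR (ln (Q s) / 4 + (s * c) ^+ 2 / (2 * Q s)).
(* [G s] is the real part of [e ^ (i e) * K s] over its expected value. *)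
pose e := d + chirp_phase b c.
pose G s := B s * (cos (e - g s) * K1 s + sin (e - g s) * K2 s).
have dG s : is_derive s (1 : R) G 0.
  have QE := lt0r_neq0 (Q0 s).
  have dQs : is_derive s (1 : R) Q (8 * s * b ^+ 2).
    by rewrite /Q; apply: is_derive_eq; rewrite /GRing.scale/=; ring.
  have dQi : is_derive s (1 : R) (fun s => (Q s)^-1)
      (- (Q s) ^- 2 * (8 * s * b ^+ 2)).
    by apply: is_derive_eq.
  have dlnQ : is_derive s (1 : R) (fun s => ln (Q s)) ((Q s)^-1 * (8 * s * b ^+ 2)).
    exact: (is_derive1_comp (is_derive1_ln (Q0 s)) dQs).
  have dg : is_derive s (1 : R) g ((b / Q s) - 3 * s ^+ 2 * b * c ^+ 2 / Q s
     + s ^+ 3 * b * c ^+ 2 * 8 * s * b ^+ 2/ (Q s) ^+ 2).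
    rewrite /g /chirp_phase.
    rewrite -/(Q _).
    apply: is_derive_eq.
    rewrite /GRing.scale/= -/(Q s).
    have -> : (2 * (s * b)) ^+ 2 = 4 * (s * b) ^+ 2 by ring.
    rewrite -/(Q s).
    by field.
  have dB : is_derive s (1 : R) B (B s * (2 * s * b ^+ 2 / Q s + s * c ^+ 2 / Q s
    - 4 * s ^+ 3 * c ^+ 2 * b ^+ 2 / (Q s) ^+ 2)).
    have dE : is_derive s (1 : R) (fun s => ln (Q s) / 4 + (s * c) ^+ 2 * (Q s)^-1 / 2)
       (2 * s * b ^+ 2 / Q s + s * c ^+ 2 / Q s
    - 4 * s ^+ 3 * c ^+ 2 * b ^+ 2 / (Q s) ^+ 2).
      apply: is_derive_eq.
      by rewrite /GRing.scale/=; field.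
    rewrite (_ : B = expR \o (fun s => ln (Q s) / 4 + (s * c) ^+ 2 * (Q s)^-1 / 2)).
      exact: is_derive1_comp.
    apply/funext => r; rewrite /B/=; congr expR.
    by have := lt0r_neq0 (Q0 r); move=> ?; field.
  rewrite /G; apply: is_derive_eq.
  rewrite /GRing.scale/=.
  set C := cos _; set S := sin _.
  rewrite /Y1 /Y2 /X1 /X2; move: QE; rewrite /Q; move: (K1 s) (K2 s) (B s) => k1 k2 B' QE.
  by field.
have K20 : K2 0 = 0.
  rewrite -[RHS](moment0 (0 * b) (0 * c) 0); apply: eq_Rintegral => y _.
  by rewrite /wave !mul0r !add0r cos_pihalf horner0 mul0r !mulr0.
have g0 : g 0 = 0 by rewrite /g /chirp_phase !mul0r mulr0 atan0 !mul0r subr0.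
have B0 : B 0 = 1.
  by rewrite /B /Q !mul0r expr0n/= mulr0 addr0 ln1 !mul0r addr0 expR0.
have : G 1 = G 0 by apply: is_derive_0_is_cst.
rewrite /G g0 B0 K20 /K1 !mul0r moment_gauss mulr0 addr0 mul1r subr0.
rewrite /K2 /g !mul1r -/K1 /e addrK -moment_phase => h.
rewrite mulrAC [_ * cos _]mulrC -h.
rewrite /chirp_decay expRN /B /Q !mul1r mulrAC mulfV ?mul1r//.
by rewrite gt_eqF// expR_gt0.
Qed.

End ChirpGaussian.

(** * Moments of Hermite polynomials *)

Section HermiteMoments.
Context {R : realType}.
Implicit Types (b c d x y : R) (n : nat).

Lemma hermite_rec n :
  hermite R n.+2 = 2 *: ('X * hermite R n.+1) - (2 * n.+1%:R) *: hermite R n.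
Proof. by rewrite [LHS]/= -/(hermite R n.+1) deriv_hermite. Qed.

Lemma sin_atan2 x : sin (atan x) = x * cos (atan x).
Proof.
have c0 : cos (atan x) != 0.
  by rewrite gt_eqF// cos_gt0_pihalf// atan_gtNpi2 atan_ltpi2.
by rewrite -[x in x * _]atanK /tan mulfVK.
Qed.

(** By momentX the moments of the Hermite polynomials satisfy a three-term
    recurrence, in which division by [a = 1 - 2 i b] multiplies by
    [cos alpha] and shifts the phase by [alpha = atan (2 * b)]. The right-hand side
    satisfies the same recurrence because of the Hermite recurrence at
    [c / sqrt (1 + 4 * b ^+ 2)], each step adding [pi / 2 + alpha] to the phase. *)
Lemma moment_hermite n b c d : moment b c d (hermite R n) =
  Num.sqrt (2 * pi) * chirp_decay b c *
  (hermite R n).[c / Num.sqrt (1 + 4 * b ^+ 2)] *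
  cos (d + n%:R * (pi / 2 + atan (2 * b)) + chirp_phase b c).
Proof.
have r0 : 0 < 1 + 4 * b ^+ 2 by rewrite ltr_wpDr// mulr_ge0// sqr_ge0.
have caE : cos (atan (2 * b)) = (Num.sqrt (1 + 4 * b ^+ 2))^-1.
  by rewrite cos_atan exprMn -natrX.
have ca2 : cos (atan (2 * b)) ^+ 2 = (1 + 4 * b ^+ 2)^-1.
  by rewrite caE exprVn sqr_sqrtr// ltW.
have rel : cos (atan (2 * b)) ^+ 2 * (1 + 4 * b ^+ 2) = 1.
  by rewrite ca2 mulVf// gt_eqF.
rewrite -caE.
have saE := sin_atan2 (2 * b).
move: (Num.sqrt (2 * pi) * chirp_decay b c) (moment_one b c) => K m1.
move: (chirp_phase b c) m1 => g m1.
have shift e : cos (e + pi / 2 + g) = - sin (e + g).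
  by rewrite addrAC cosDpihalf.
elim/ltn_ind: n d => -[|[|n]] IH d.
- by rewrite /= hornerC mulr1 mul0r addr0 m1.
- have -> : hermite R 1 = 2 *: ('X * 1) by rewrite /= -polyC1 derivC subr0.
  rewrite momentZ momentX -ca2 -polyC1 derivC polyC1.
  have -> : d + 1%:R * (pi / 2 + atan (2 * b)) + g =
    d + g + atan (2 * b) + pi / 2 by ring.
  rewrite !moment0 !m1 shift mulr1 hornerZ hornerX cosDpihalf sinD saE.
  by move: (cos (atan _)) (cos _) (sin _) => *; ring.
rewrite hermiteSS [X in moment _ _ _ X]hermite_rec momentB !momentZ momentX.
rewrite deriv_hermite !momentZ -ca2.
rewrite !IH//.
set h0 := (hermite R n).[_]; set h1 := (hermite R n.+1).[_].
set a := atan (2 * b) in ca2 saE rel caE h0 h1 *.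
set f := d + n%:R * (pi / 2 + a) + g.
have -> : d + pi / 2 + n%:R * (pi / 2 + a) + g = f + pi / 2 by rewrite /f; ring.
have -> : d + n.+1%:R * (pi / 2 + a) + g = f + a + pi / 2.
  by rewrite /f -natr1; ring.
have -> : d + pi / 2 + n.+1%:R * (pi / 2 + a) + g = f + a + pi / 2 + pi / 2.
  by rewrite /f -natr1; ring.
have -> : d + n.+2%:R * (pi / 2 + a) + g = f + a + a + pi / 2 + pi / 2.
  by rewrite /f -2!natr1; ring.
rewrite !cosDpihalf !sinDpihalf !(cosD _ a) !(sinD _ a) saE.
move: (cos f) (sin f) (cos a) rel => cf sf ca rel.
(* The two sides agree up to [cos alpha ^+ 2 * (1 + 4 * b ^+ 2) = 1]. *)
apply/eqP; rewrite -subr_eq0; apply/eqP.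
transitivity (2 * n.+1%:R * K * h0 * cf * (ca ^+ 2 * (1 + 4 * b ^+ 2) - 1)).
  by ring.
by rewrite rel subrr mulr0.
Qed.

End HermiteMoments.

(** * Evolution of Hermite functions *)

Section Evolution.
Context {R : realType}.
Implicit Types (b c d x y u : R) (n : nat).

Definition cis x : R[i] := cos x +i* sin x.

Lemma cisD x y : cis (x + y) = cis x * cis y.
Proof.
apply/eqP; rewrite eq_complex /= cosD sinD eqxx /=.
by apply/eqP; ring.
Qed.

Lemma cis0 : cis 0 = 1. Proof. by rewrite /cis cos0 sin0. Qed.

Lemma cisN_mul x : cis (- x) * cis x = 1. Proof. by rewrite -cisD addNr cis0. Qed.

Lemma cisN x : cis (- x) = (cis x)^-1.
Proof.
have c0 : cis x != 0.
  by apply/eqP => h; have /eqP := cisN_mul x; rewrite h mulr0 eq_sym oner_eq0.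
by apply: (mulIf c0); rewrite cisN_mul mulVf.
Qed.

Lemma norm_cis x : `|cis x| = 1.
Proof. by rewrite normc_def /= cos2Dsin2 sqrtr1. Qed.

Lemma cexp_imag y : cexp (y *i) = cis y.
Proof. by rewrite /cexp /= expR0 mul1r. Qed.

Lemma cexp_imagN y : cexp (- (y *i)) = cis (- y).
Proof. by rewrite /cexp /= oppr0 expR0 mul1r. Qed.

Lemma hermiteN n x : (hermite R n).[- x] = (-1) ^+ n * (hermite R n).[x].
Proof.
elim/ltn_ind: n => -[|[|n]] IH.
- by rewrite /= !hornerC mul1r.
- by rewrite /= -polyC1 derivC subr0 !hornerZ !hornerM !hornerX !hornerC; ring.
by rewrite !hermiteSS !IH// 3!exprS; ring.
Qed.

Lemma cis_natpi n : cis (n%:R * pi) = ((-1) ^+ n)%:C.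
Proof.
elim: n => [|n IH]; first by rewrite mul0r cis0.
rewrite -natr1 mulrDl mul1r cisD IH exprSr rmorphM /=; congr (_ * _).
by rewrite /cis cospi sinpi; apply/eqP; rewrite eq_complex /= ?oppr0 !eqxx.
Qed.

(** Common form of the two integrals to be computed: the Fourier transform of a
    Hermite function has [b = 0], and the evolution at time [t] has
    [b = eps * t]. *)
Lemma cintegral_hermite_chirp n b c d N (f : R -> R[i]) :
  (forall y, f y = (N * (hermite R n).[y] * expR (- (y ^+ 2 / 2)))%:C *
     cis (b * y ^+ 2 + c * y + d)) ->
  cintegral f = (N * (Num.sqrt (2 * pi) * chirp_decay b c *
      (hermite R n).[c / Num.sqrt (1 + 4 * b ^+ 2)]))%:C *
    cis (d + n%:R * (pi / 2 + atan (2 * b)) + chirp_phase b c).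
Proof.
move=> fE; set K := _ * (hermite R n).[_ / _].
have -> : cintegral f =
    (N * moment b c d (hermite R n)) +i* (N * moment b c (d - pi / 2) (hermite R n)).
  congr (_ +i* _); rewrite -momentZ; apply: eq_Rintegral => y _.
    by rewrite fE /= hornerZ mul0r subr0 /wave !mulrA.
  by rewrite fE /= hornerZ mul0r addr0 /wave addrA cosBpihalf !mulrA.
rewrite !moment_hermite -/K.
rewrite (_ : d - pi / 2 + _ + _ =
  d + n%:R * (pi / 2 + atan (2 * b)) + chirp_phase b c - pi / 2); last by ring.
rewrite cosBpihalf.
by apply/eqP; rewrite eq_complex /= !mul0r subr0 addr0 !mulrA !eqxx.
Qed.

(** Hermite functions are eigenfunctions of the Fourier transform, with eigenvalue
    [(- i) ^ n]. The integral evaluates at [- y] with the factor [i ^ n], and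
    parity turns this into the stated form. *)
Lemma fourier_hermite n y :
  fourier (fun y => (hermite_fun n y)%:C) y =
  (hermite_fun n y)%:C * cis (- (n%:R * (pi / 2))).
Proof.
pose N := (Num.sqrt (2 ^+ n * n`!%:R * Num.sqrt pi) : R)^-1.
have sp : Num.sqrt (2 * pi : R) != 0.
  by rewrite gt_eqF// sqrtr_gt0 mulr_gt0// pi_gt0.
rewrite /fourier (@cintegral_hermite_chirp n 0 (- y) 0 N); last first.
  move=> z; rewrite /hermite_fun -/N cexp_imagN; congr (_ * cis _).
  by ring.
rewrite /chirp_decay /chirp_phase expr0n /= !mulr0 addr0 ln1 sqrtr1 atan0 !mul0r.
rewrite add0r sqrrN !addr0 subr0 invr1 !mulr1 hermiteN !addr0 add0r.
rewrite (_ : cis (n%:R * _) = ((-1) ^+ n)%:C * cis (- (n%:R * (pi / 2)))); last first.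
  by rewrite -cis_natpi -cisD; congr cis; field.
rewrite !mulrA -!rmorphM /=; congr (_%:C * _).
rewrite /hermite_fun -/N.
have := sqrr_sign R n; move: ((-1) ^+ n) => e e2.
transitivity ((Num.sqrt (2 * pi))^-1 * Num.sqrt (2 * pi) * (e ^+ 2) *
  (N * (hermite R n).[y] * expR (- (y ^+ 2 / 2)))); first by ring.
by rewrite e2 mulr1 mulVf// mul1r.
Qed.

Lemma carg_right u : carg (1 +i* u) = atan u.
Proof.
rewrite /carg normc_def /= expr1n div1r.
have pos v : 0 <= v -> acos (Num.sqrt (1 + v ^+ 2))^-1 = atan v :> R.
  move=> v0; rewrite -cos_atan cosK// in_itv/= -{1}atan0 le_atan//=.
  by rewrite (le_trans (ltW (atan_ltpi2 _)))// ler_pdivrMr// ler_peMr ?pi_ge0// ler1n.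
case: ifPn => [/pos->//|]; rewrite -ltNge => u0.
by rewrite -sqrrN pos ?atanN ?opprK// oppr_ge0 ltW.
Qed.

Lemma cpow_right u a :
  cpow (1 +i* u) a = (expR (a * (ln (1 + u ^+ 2) / 2)))%:C * cis (a * atan u).
Proof.
have h : 0 < 1 + u ^+ 2 by rewrite ltr_wpDr// sqr_ge0.
rewrite /cpow ifF; last first.
  by apply/negbTE; rewrite eq_complex /= oner_eq0.
rewrite /clog carg_right normc_def /= expr1n /cexp /=.
rewrite mul0r subr0 mul0r addr0.
rewrite (_ : ln (Num.sqrt _) = ln (1 + u ^+ 2) / 2)//.
rewrite -[in RHS](sqr_sqrtr (ltW h)) lnXn ?sqrtr_gt0//.
by rewrite mulr2n; lra.
Qed.

(** The factor [(- i) ^ n] from the Fourier transform cancels the [n] quarter turns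
    of the chirp integral, which leaves [n] rotations by [atan (2 * eps * t)]. *)
Lemma hermite_evolution_polar eps n x t :
  hermite_evolution eps n x t =
  (expR (- (ln (1 + 4 * eps ^+ 2 * t ^+ 2) / 4)) *
    hermite_fun n (x / Num.sqrt (1 + 4 * eps ^+ 2 * t ^+ 2)))%:C *
  cis (n%:R * atan (2 * eps * t) + atan (2 * eps * t) / 2
       - t * eps * x ^+ 2 / (1 + 4 * eps ^+ 2 * t ^+ 2)).
Proof.
pose N := (Num.sqrt (2 ^+ n * n`!%:R * Num.sqrt pi) : R)^-1.
have sp : Num.sqrt (2 * pi : R) != 0.
  by rewrite gt_eqF// sqrtr_gt0 mulr_gt0// pi_gt0.
rewrite /hermite_evolution /free_schrodinger.
rewrite (@cintegral_hermite_chirp n (eps * t) x (- (n%:R * (pi / 2))) N); last first.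
  move=> y; rewrite fourier_hermite -mulrA; congr (_ * _).
  rewrite (_ : _ + _ = (y ^+ 2 * eps * t + y * x) *i); last first.
    by apply/eqP; rewrite eq_complex /= addr0 !eqxx.
  by rewrite cexp_imag -cisD; congr cis; ring.
have r2E : 1 + 4 * eps ^+ 2 * t ^+ 2 = 1 + 4 * (eps * t) ^+ 2 by ring.
have r0 : 0 < 1 + 4 * (eps * t) ^+ 2 by rewrite ltr_wpDr// mulr_ge0// sqr_ge0.
rewrite r2E [LHS]mulrA -rmorphM /=; congr (_%:C * cis _); last first.
  by rewrite /chirp_phase !mulrA; ring.
rewrite /chirp_decay /hermite_fun -/N (expr_div_n x) sqr_sqrtr ?ltW//.
rewrite opprD expRD (_ : x ^+ 2 / (2 * (1 + 4 * (eps * t) ^+ 2)) =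
  x ^+ 2 / (1 + 4 * (eps * t) ^+ 2) / 2); last by field; rewrite gt_eqF.
move: (expR _) (expR _) => e1 e2; by field.
Qed.

(** With [z = 1 + 2 i eps t], the moduli of [z] and its conjugate agree, so the
    quotient of powers has modulus [|z| ^ (- 1 / 2)], while the arguments, which
    are opposite, add up. *)
Lemma evolution_closed_form eps n x t :
    hermite_evolution eps n x t =
      cpow (1 +i* (2 * eps * t)) (n%:R / 2)
      / cpow (1 -i* (2 * eps * t)) (n.+1%:R / 2)
      * cexp (- (t * eps * x ^+ 2 / (1 + 4 * eps ^+ 2 * t ^+ 2))*i)
      * (hermite_fun n (x / Num.sqrt (1 + 4 * eps ^+ 2 * t ^+ 2)))%:C.
Proof.
rewrite hermite_evolution_polar !cpow_right cexp_imagN.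
have -> : 1 + (2 * eps * t) ^+ 2 = 1 + 4 * eps ^+ 2 * t ^+ 2 by ring.
have -> : 1 + (- (2 * eps * t)) ^+ 2 = 1 + 4 * eps ^+ 2 * t ^+ 2 by ring.
set L := ln _; set a := atan (2 * eps * t).
set p := t * eps * x ^+ 2 / _.
rewrite atanN -/a invfM -cisN -fmorphV -expRN.
transitivity ((expR (n%:R / 2 * (L / 2)) * expR (- (n.+1%:R / 2 * (L / 2))) *
  hermite_fun n (x / Num.sqrt (1 + 4 * eps ^+ 2 * t ^+ 2)))%:C *
  (cis (n%:R / 2 * a) * cis (- (n.+1%:R / 2 * - a)) * cis (- p))); last first.
  by rewrite !rmorphM /=; ring.
rewrite -expRD -!cisD -natr1.
by congr ((expR _ * _)%:C * cis _); field.
Qed.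

Lemma evolution_bound_of_sup n :
  (forall y, `|hermite_fun n y| <= (pi `^ (1 / 4) : R)^-1) ->
  forall eps x t, `|hermite_evolution eps n x t| <=
      (1 / (pi * (1 + 4 * eps ^+ 2 * t ^+ 2)) `^ (1 / 4))%:C.
Proof.
move=> sup eps x t; rewrite hermite_evolution_polar normrM norm_cis mulr1.
have r0 : 0 < 1 + 4 * eps ^+ 2 * t ^+ 2.
  rewrite (_ : _ * t ^+ 2 = (2 * eps * t) ^+ 2); last by ring.
  by rewrite ltr_wpDr// sqr_ge0.
set r := 1 + _ in r0 *; rewrite normc_def /= expr0n addr0 sqrtr_sqr lecR.
have -> : expR (- (ln r / 4)) = (r `^ (1 / 4))^-1.
  by rewrite expRN /powR gt_eqF// mulrC div1r.
move: (1 / 4) sup => q sup.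
rewrite (powRM _ (pi_ge0 R) (ltW r0)) div1r invfM [leRHS]mulrC normrM.
rewrite [X in X * _]ger0_norm ?invr_ge0 ?powR_ge0//.
by rewrite ler_wpM2l// invr_ge0 powR_ge0.
Qed.
End Evolution.

(** * The maximum of Hermite functions *)

Section HermiteSup.
Context {R : realType}.
Implicit Types (x y t : R) (n : nat).

Definition hermite_norm n : R := (Num.sqrt (2 ^+ n * n`!%:R * Num.sqrt pi))^-1.

(** Coefficient of the ladder operators: [phi_n' = x phi_n - ladder n phi_(n+1)]
    and [phi_(n+1)' = ladder n phi_n - x phi_(n+1)]. *)
Definition ladder n : R := Num.sqrt (2 * n.+1%:R).

Lemma ladder_gt0 n : 0 < ladder n.
Proof. by rewrite sqrtr_gt0 mulr_gt0. Qed.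

Lemma ladder_sqr n : ladder n ^+ 2 = 2 * n.+1%:R.
Proof. by rewrite sqr_sqrtr// mulr_ge0. Qed.

Lemma hermite_normS n : hermite_norm n = ladder n * hermite_norm n.+1.
Proof.
have w0 : ladder n != 0 by rewrite gt_eqF// ladder_gt0.
rewrite /hermite_norm.
have -> : 2 ^+ n.+1 * n.+1`!%:R * Num.sqrt pi =
    2 * n.+1%:R * (2 ^+ n * n`!%:R * Num.sqrt pi) :> R.
  by rewrite factS natrM exprS; ring.
by rewrite [in RHS]sqrtrM ?mulr_ge0// invfM mulVKf.
Qed.

Lemma is_derive_hermite_fun n x :
  is_derive x (1 : R) (hermite_fun n)
    (x * hermite_fun n x - ladder n * hermite_fun n.+1 x).
Proof.
rewrite /hermite_fun -/(hermite_norm n) -/(hermite_norm n.+1) (hermite_normS n).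
apply: is_derive_eq; rewrite /GRing.scale/=.
rewrite hornerD hornerN hornerZ hornerM hornerX.
by field.
Qed.

Lemma is_derive_hermite_funS n x :
  is_derive x (1 : R) (hermite_fun n.+1)
    (ladder n * hermite_fun n x - x * hermite_fun n.+1 x).
Proof.
have := ladder_sqr n.
rewrite /hermite_fun -/(hermite_norm n) -/(hermite_norm n.+1) (hermite_normS n) => w2.
move: (hermite R n.+1) (deriv_hermite R n) => P dP.
apply: is_derive_eq; rewrite /GRing.scale/= dP hornerZ -w2.
by field.
Qed.

Lemma hermite_fun_rec n x : ladder n.+1 * hermite_fun n.+2 x =
  2 * x * hermite_fun n.+1 x - ladder n * hermite_fun n x.
Proof.
have [_ h1] := is_derive_hermite_fun n.+1 x.
have [_ h2] := is_derive_hermite_funS n x.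
by have := h1; rewrite h2; move=> h; lra.
Qed.

Lemma hermite_funN n x : hermite_fun n (- x) = (-1) ^+ n * hermite_fun n x.
Proof. by rewrite /hermite_fun hermiteN sqrrN; ring. Qed.

(** Closed form of twice the sum of [hermite_fun k t ^+ 2] over [k <= n], by the
    Christoffel-Darboux formula. *)
Definition christoffel n t : R :=
  2 * n.+1%:R * (hermite_fun n.+1 t ^+ 2 + hermite_fun n t ^+ 2)
  - 2 * ladder n * t * hermite_fun n.+1 t * hermite_fun n t.

(** The increment from [n] to [n + 1] is [2 * hermite_fun n.+1 t ^+ 2], and the
    initial value is [2 * hermite_fun 0 t ^+ 2]. *)
Lemma christoffel_gt0 n t : 0 < christoffel n t.
Proof.
elim: n => [|n IH].
  have : ladder 0 * hermite_fun 1 t = 2 * t * hermite_fun 0 t.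
    rewrite /hermite_fun -/(hermite_norm 0) -/(hermite_norm 1) (hermite_normS 0) /=.
    rewrite -polyC1 derivC subr0 mulr1 hornerZ hornerX hornerC.
    by ring.
  have := ladder_sqr 0; rewrite /christoffel mulr1 => w2 h.
  have -> : 2 * (hermite_fun 1 t ^+ 2 + hermite_fun 0 t ^+ 2) -
      2 * ladder 0 * t * hermite_fun 1 t * hermite_fun 0 t
    = 2 * hermite_fun 0 t ^+ 2 + (2 - ladder 0 ^+ 2) * hermite_fun 1 t ^+ 2
      + ladder 0 * hermite_fun 1 t *
        (ladder 0 * hermite_fun 1 t - 2 * t * hermite_fun 0 t) by ring.
  rewrite w2 h !subrr mul0r mulr0 !addr0 mulr_gt0// exprn_gt0//.
  rewrite /hermite_fun /= hornerC mulr1 mulr_gt0 ?expR_gt0// invr_gt0 sqrtr_gt0.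
  by rewrite mulr_gt0// sqrtr_gt0 pi_gt0.
have -> : christoffel n.+1 t = christoffel n t + 2 * hermite_fun n.+1 t ^+ 2.
  rewrite /christoffel -!ladder_sqr.
  have h := hermite_fun_rec n t.
  apply/eqP; rewrite -subr_eq0; apply/eqP.
  move: (ladder n) (ladder n.+1) (ladder_sqr n) (ladder_sqr n.+1) h => s0 s1 e0 e1 h.
  have e2 : s1 ^+ 2 = s0 ^+ 2 + 2 by rewrite e0 e1 -natr1; ring.
  transitivity ((s1 * hermite_fun n.+2 t - s0 * hermite_fun n t) *
    (s1 * hermite_fun n.+2 t -
     (2 * t * hermite_fun n.+1 t - s0 * hermite_fun n t))
    + (s1 ^+ 2 - (s0 ^+ 2 + 2)) * hermite_fun n.+1 t ^+ 2); first by ring.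
  by rewrite h e2 !subrr mulr0 mul0r addr0.
by rewrite ltr_wpDr// mulr_ge0// sqr_ge0.
Qed.

(** A Sonin-type function that interpolates between two consecutive Hermite
    functions: it equals [hermite_fun n.+1 t ^+ 2] at the critical points of
    [hermite_fun n.+1], and [hermite_fun n t ^+ 2] at those of [hermite_fun n]. *)
Definition sonin n t : R := christoffel n t / (2 * n.+1%:R - t ^+ 2).

Lemma sonin_upper n t : 2 * n.+1%:R - t ^+ 2 != 0 ->
  sonin n t = hermite_fun n.+1 t ^+ 2 +
    (ladder n * hermite_fun n t - t * hermite_fun n.+1 t) ^+ 2
    / (2 * n.+1%:R - t ^+ 2).
Proof.
rewrite /sonin /christoffel -ladder_sqr => D0.
by field.
Qed.

Lemma sonin_lower n t : 2 * n.+1%:R - t ^+ 2 != 0 ->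
  sonin n t = hermite_fun n t ^+ 2 +
    (t * hermite_fun n t - ladder n * hermite_fun n.+1 t) ^+ 2
    / (2 * n.+1%:R - t ^+ 2).
Proof.
rewrite /sonin /christoffel -ladder_sqr => D0.
by field.
Qed.

(** The derivative is a multiple of the product of the derivatives of the two
    Hermite functions, so a critical point of [sonin n] is a critical point of one
    of them. *)
Lemma is_derive_sonin n t : 2 * n.+1%:R - t ^+ 2 != 0 ->
  is_derive t (1 : R) (sonin n)
    (2 * ladder n / (2 * n.+1%:R - t ^+ 2) ^+ 2 *
     ((ladder n * hermite_fun n t - t * hermite_fun n.+1 t) *
      (t * hermite_fun n t - ladder n * hermite_fun n.+1 t))).
Proof.
move=> D0.
have dp := is_derive_hermite_funS n t.
have dq := is_derive_hermite_fun n t.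
rewrite /sonin /christoffel -ladder_sqr in D0 *.
move: (ladder n) (hermite_fun n.+1) (hermite_fun n) D0 dp dq => s p q D0 dp dq.
have dD : is_derive t (1 : R) (fun t => (s ^+ 2 - t ^+ 2)^-1)
    (- (s ^+ 2 - t ^+ 2) ^- 2 * (- 2 * t)).
  apply: is_derive_eq.
  by rewrite /GRing.scale/=; field.
apply: is_derive_eq.
by rewrite /GRing.scale/=; field.
Qed.

Lemma hermite_fun_small n e : 0 < e ->
  exists B, forall t, B <= t -> `|hermite_fun n t| < e.
Proof.
move=> e0; have [C C0 HC] := poly_gauss_le (hermite R n).
pose K := hermite_norm n * C.
have N0 : 0 <= hermite_norm n by rewrite /hermite_norm invr_ge0 sqrtr_ge0.
exists (2 + 2 * (K / e)) => t Bt.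
have K0 : 0 <= K / e by rewrite divr_ge0 ?mulr_ge0// ltW.
have le : `|hermite_fun n t| <= K * expR (- (t ^+ 2 / 4)).
  rewrite /hermite_fun -/(hermite_norm n) !normrM (ger0_norm N0).
  by rewrite (ger0_norm (expR_ge0 _)) /K -[leLHS]mulrA -[leRHS]mulrA ler_wpM2l.
rewrite (le_lt_trans le)// expRN ltr_pdivrMr ?expR_gt0//.
have : K / e < expR (t ^+ 2 / 4).
  rewrite (lt_le_trans _ (expR_ge1Dx _))//.
  have : (2 + 2 * (K / e)) * 2 <= t ^+ 2.
    rewrite expr2 ler_pM//; first by lra.
    by rewrite (le_trans _ Bt)//; lra.
  by lra.
by rewrite ltr_pdivrMr// mulrC.
Qed.

Lemma hermite_fun_odd0 n : odd n -> hermite_fun n (0 : R) = 0.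
Proof.
move=> on; have := hermite_funN n 0.
by rewrite oppr0 -signr_odd on expr1; lra.
Qed.

(** At a critical point [x] of [p = hermite_fun n.+1], the derivative of [p] changes
    sign because [p''] and [p] have opposite signs, while the derivative of
    [hermite_fun n] has the sign of [- p x]. By is_derive_sonin, [sonin n]
    then decreases strictly just before [x]. *)
Lemma sonin_gt_left n x : 0 < x -> x ^+ 2 < 2 * n.+1%:R ->
  ladder n * hermite_fun n x = x * hermite_fun n.+1 x ->
  hermite_fun n.+1 x != 0 ->
  exists2 t, 0 <= t <= x & sonin n x < sonin n t.
Proof.
move=> x0 xn px pn0.
set p := hermite_fun n.+1 in px pn0 *; set q := hermite_fun n in px *.
set s := ladder n in px *.
have s0 : 0 < s := ladder_gt0 n.
pose u t := s * q t - t * p t.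
pose v t := t * q t - s * p t.
have dp t : is_derive t (1 : R) p (u t) := is_derive_hermite_funS n t.
have dq t : is_derive t (1 : R) q (v t) := is_derive_hermite_fun n t.
have du t : is_derive t (1 : R) u (- ((2 * n.+1%:R - t ^+ 2 + 1) * p t)).
  rewrite /u; apply: is_derive_eq.
  rewrite /GRing.scale/= /u /v -ladder_sqr -/s.
  by ring.
have dv t : is_derive t (1 : R) v (q t + t * v t - s * u t).
  rewrite /v; apply: is_derive_eq.
  by rewrite /GRing.scale/= /u /v; ring.
have cp := is_derive_continuous _ _ dp.
have cv := is_derive_continuous _ _ dv.
have cu := is_derive_continuous _ _ du.
have pp : 0 < p x ^+ 2 by rewrite exprn_even_gt0.
have vp : v x * p x < 0.
  rewrite -(pmulr_rlt0 _ s0).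
  have -> : s * (v x * p x) = (x * (s * q x) - s ^+ 2 * p x) * p x.
    by rewrite /v; ring.
  rewrite px.
  have -> : (x * (x * p x) - s ^+ 2 * p x) * p x =
    - ((s ^+ 2 - x ^+ 2) * p x ^+ 2) by ring.
  by rewrite oppr_lt0 mulr_gt0// subr_gt0 ladder_sqr.
have : \forall t \near x, 0 < p t * p x.
  have /cvgr_gt : p t * p x @[t --> x] --> p x * p x.
    by apply: cvgM; [exact: cp|exact: cvg_cst].
  by apply; rewrite -expr2.
have : \forall t \near x, v t * p x < 0.
  have /cvgr_lt : v t * p x @[t --> x] --> v x * p x.
    by apply: cvgM; [exact: cv|exact: cvg_cst].
  exact.
move=> /nbhs_ballP[d1 /= d10 hv] /nbhs_ballP[d2 /= d20 hp].
pose d := Num.min x (Num.min d1 d2) / 2.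
have d0 : 0 < d by rewrite divr_gt0// !lt_min x0 d10 d20.
have dm : d < Num.min x (Num.min d1 d2).
  by rewrite ltr_pdivrMr// ltr_pMr// ?ltr1n// !lt_min x0 d10 d20.
move: dm; rewrite !lt_min => /and3P[dx dd1 dd2].
exists (x - d); first by rewrite subr_ge0 gerBl !ltW.
have xd : x - d < x by rewrite gtrBl.
have near t : t \in `]x - d, x[ -> 0 < p t * p x /\ v t * p x < 0.
  rewrite in_itv/= => /andP[t1 t2].
  have h e : d < e -> `|x - t| < e by move=> de; rewrite ger0_norm; lra.
  by split; [apply: hp|apply: hv]; rewrite /ball/= h.
have D0 t : t \in `]x - d, x] -> 0 < 2 * n.+1%:R - t ^+ 2.
  rewrite in_itv/= => /andP[t1 t2]; rewrite subr_gt0 (le_lt_trans _ xn)//.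
  by rewrite ler_pXn2r// nnegrE; lra.
have upos t : t \in `]x - d, x[ -> 0 < u t * p x.
  move=> tI; have := tI; rewrite in_itv/= => /andP[t1 t2].
  have [|z zI] := @MVT _ u _ t x t2 (fun y _ => du y).
    exact: continuous_subspaceT.
  move: (zI); rewrite in_itv/= => /andP[tz zx].
  have -> : u x = 0 by rewrite /u px subrr.
  rewrite sub0r => /eqP; rewrite eqr_oppLR mulNr opprK => /eqP ->.
  have zI' : z \in `]x - d, x[ by rewrite in_itv/= zx (lt_trans t1).
  have [pz _] := near _ zI'.
  have -> : (2 * n.+1%:R - z ^+ 2 + 1) * p z * (x - t) * p x =
    (2 * n.+1%:R - z ^+ 2 + 1) * (x - t) * (p z * p x) by ring.
  rewrite mulr_gt0// mulr_gt0 ?subr_gt0// addr_gt0// D0// in_itv/=.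
  by rewrite (lt_trans t1)//= ltW.
pose dF t := 2 * s / (2 * n.+1%:R - t ^+ 2) ^+ 2 * (u t * v t).
have [||z zI] := @MVT R (sonin n) dF (x - d) x xd.
- move=> y; rewrite in_itv/= => /andP[y1 y2]; apply: is_derive_sonin.
  by rewrite gt_eqF// D0// in_itv/= y1 ltW.
- apply: derivable_within_continuous => y; rewrite in_itv/= => /andP[y1 y2].
  have [] := is_derive_sonin n y => //.
  rewrite subr_eq0 gt_eqF// (le_lt_trans _ xn)// ler_pXn2r// nnegrE; lra.
move=> h; rewrite -subr_lt0 h /dF.
have [_ vz] := near _ zI; have uz := upos _ zI.
have uv : u z * v z < 0.
  rewrite -(pmulr_llt0 _ pp).
  have -> : u z * v z * p x ^+ 2 = (u z * p x) * (v z * p x) by ring.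
  by rewrite pmulr_rlt0.
rewrite nmulr_rlt0 ?subr_gt0// pmulr_rlt0// mulr_gt0 ?mulr_gt0//.
rewrite invr_gt0 exprn_gt0// D0//.
by move: zI; rewrite !in_itv/= => /andP[-> /ltW].
Qed.

(** Suppose that [p = hermite_fun n.+1] exceeds [M] and let [x > 0] be a point of the half line
    where [|p|] is largest. Positivity of the Christoffel sum puts [x] inside the
    interval where [sonin n] is smooth. The maximum of [sonin n] on
    [[0, x]] exceeds [sonin n x = p x ^+ 2] and is attained at a critical point of [p]
    or of [hermite_fun n] (at the origin one of the two vanishes). Its value is
    therefore a value of [p ^+ 2], against the choice of [x], or a value of
    [hermite_fun n ^+ 2], which is at most [M ^+ 2]. *)
Lemma hermite_fun_sup_step n (M : R) : (forall y, `|hermite_fun n y| <= M) ->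
  `|hermite_fun n.+1 0| <= M -> forall y, `|hermite_fun n.+1 y| <= M.
Proof.
move=> qM p0M.
suff nonneg y : 0 <= y -> `|hermite_fun n.+1 y| <= M.
  move=> y; have [/nonneg//|y0] := leP 0 y.
  rewrite -[y]opprK hermite_funN normrM normrX normrN1 expr1n mul1r.
  by rewrite nonneg// oppr_ge0 ltW.
move=> y0; rewrite leNgt; apply/negP => yM.
have M0 : 0 <= M by rewrite (le_trans _ p0M).
have [B HB] := hermite_fun_small n.+1 _ (le_lt_trans M0 yM).
set p := hermite_fun n.+1 in p0M yM HB *; set q := hermite_fun n in qM *.
have dp t : is_derive t (1 : R) p (ladder n * q t - t * p t) :=
  is_derive_hermite_funS n t.
have dp2 t : is_derive t (1 : R) (fun t => p t ^+ 2)
    (2 * p t * (ladder n * q t - t * p t)).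
  by apply: is_derive_eq; rewrite /GRing.scale/=; ring.
pose B' := Num.max B y.
have B0 : 0 <= B' by rewrite le_max y0 orbT.
have [x xI xmax] := @EVT_max R (fun t => p t ^+ 2) 0 B' B0
  (continuous_subspaceT (is_derive_continuous _ _ dp2)).
have yI : y \in `[0, B'] by rewrite in_itv/= y0 le_max lexx orbT.
have W : M ^+ 2 < p x ^+ 2.
  rewrite (lt_le_trans _ (xmax _ yI))// -[ltRHS]real_normK ?num_real//.
  by rewrite ltr_pXn2r.
have xn0 : x != 0.
  apply/eqP => x00; move: W; rewrite x00 -[ltRHS]real_normK ?num_real//.
  by rewrite ltr_pXn2r// ltNge p0M.
have xnB : x != B'.
  apply/eqP => xB; have := xmax _ yI; rewrite xB.
  rewrite -[leLHS]real_normK ?num_real// -[leRHS]real_normK ?num_real//.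
  by rewrite ler_pXn2r// leNgt HB// le_max lexx.
have {xI} /andP[x0 xB] : 0 < x < B'.
  move: xI; rewrite in_itv/= => /andP[? ?].
  rewrite !lt_neqAle eq_sym xn0 xnB; exact/andP.
have px : ladder n * q x = x * p x.
  have [|||_ h] := @derive1_at_max R (fun t => p t ^+ 2) 0 B' x B0.
  - by move=> t _; have [] := dp2 t.
  - by rewrite in_itv/= x0.
  - by move=> t; rewrite in_itv/= => /andP[? ?]; apply: xmax; rewrite in_itv/= !ltW.
  have [_ h2] := dp2 x; move: h; rewrite h2 => /eqP.
  rewrite mulf_eq0 mulf_eq0 pnatr_eq0/= subr_eq0 => /orP[/eqP pz|/eqP//].
  by move: W; rewrite pz expr0n/= ltNge sqr_ge0.
have pn0 : p x != 0.
  by apply/eqP => pz; move: W; rewrite pz expr0n/= ltNge sqr_ge0.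
have xn : x ^+ 2 < 2 * n.+1%:R.
  have := christoffel_gt0 n x; rewrite /christoffel -/p -/q -ladder_sqr.
  rewrite (_ : _ - _ = (ladder n ^+ 2 - x ^+ 2) * p x ^+ 2 +
    (ladder n * q x - x * p x) ^+ 2); last by ring.
  by rewrite px subrr expr0n/= addr0 pmulr_lgt0 ?subr_gt0// exprn_even_gt0.
have D0 t : 0 <= t <= x -> 2 * n.+1%:R - t ^+ 2 != 0.
  move=> /andP[t0 tx]; rewrite subr_eq0 gt_eqF// (le_lt_trans _ xn)//.
  by rewrite ler_pXn2r// nnegrE ltW.
have Fx : sonin n x = p x ^+ 2.
  by rewrite sonin_upper ?D0 ?lexx ?ltW// -/p -/q px subrr expr0n/= mul0r addr0.
have [t tI Ft] := sonin_gt_left n x x0 xn px pn0.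
have cF : {within `[0, x], continuous (sonin n)}.
  apply: derivable_within_continuous => z zI.
  by have [] := is_derive_sonin n z (D0 z zI).
have [z zI zmax] := @EVT_max R (sonin n) 0 x (ltW x0) cF.
have Fz : p x ^+ 2 < sonin n z by rewrite -Fx (lt_le_trans Ft)// zmax.
have pz : p z ^+ 2 <= p x ^+ 2.
  apply: xmax; move: zI; rewrite !in_itv/= => /andP[-> zx].
  by rewrite (le_trans zx)// ltW.
have qz : q z ^+ 2 < p x ^+ 2.
  rewrite (le_lt_trans _ W)// -[leLHS]real_normK ?num_real//.
  by rewrite ler_pXn2r.
have Fpq : (sonin n z == p z ^+ 2) || (sonin n z == q z ^+ 2).
  have [z0|z0] := eqVneq z 0.
    have F0 : sonin n 0 = p 0 ^+ 2 + q 0 ^+ 2.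
      rewrite /sonin /christoffel -/p -/q -ladder_sqr.
      by field; rewrite gt_eqF// ladder_gt0.
    rewrite z0 F0; case: (boolP (odd n)) => on.
      have -> : q 0 = 0 by apply: hermite_fun_odd0.
      by rewrite expr0n addr0 eqxx.
    have -> : p 0 = 0 by apply: hermite_fun_odd0.
    by rewrite expr0n add0r eqxx orbT.
  have zx : z != x by apply/eqP => zx; move: Fz; rewrite zx Fx ltxx.
  have {}zI : z \in `]0, x[.
    move: zI; rewrite !in_itv/= => /andP[? ?].
    rewrite !lt_neqAle eq_sym z0 zx; exact/andP.
  have [|||_ h] := @derive1_at_max R (sonin n) 0 x z (ltW x0).
  - move=> r; rewrite in_itv/= => /andP[? ?].
    by have [] := is_derive_sonin n r (D0 r _) => //; rewrite !ltW.
  - exact: zI.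
  - by move=> r; rewrite in_itv/= => /andP[? ?]; apply: zmax; rewrite in_itv/= !ltW.
  have zD : 2 * n.+1%:R - z ^+ 2 != 0.
    by move: zI; rewrite in_itv/= => /andP[? ?]; rewrite D0// !ltW.
  have [_ h2] := is_derive_sonin n z zD; move: h; rewrite h2 => /eqP.
  rewrite mulf_eq0 (gt_eqF _) /=; last first.
    apply: divr_gt0; last by rewrite exprn_even_gt0.
    by rewrite mulr_gt0// ladder_gt0.
  rewrite mulf_eq0 => /orP[]/eqP e.
    by rewrite sonin_upper// e expr0n/= mul0r addr0 eqxx.
  by rewrite sonin_lower// e expr0n/= mul0r addr0 eqxx orbT.
by case/orP: Fpq => /eqP e; move: Fz; rewrite e ltNge ?pz// ltW.
Qed.

(** The ground state has maximum [pi ^ (- 1 / 4)] and the previous lemma propagates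
    this bound. At the origin the three-term recurrence gives
    [|hermite_fun n.+2 0| <= |hermite_fun n 0|]. *)
Lemma hermite_fun_sup n y : `|hermite_fun n y| <= (pi `^ (1 / 4) : R)^-1.
Proof.
have M0 : 0 < (pi `^ (1 / 4) : R)^-1 by rewrite invr_gt0 powR_gt0// pi_gt0.
have E0 : hermite_norm 0 = (pi `^ (1 / 4) : R)^-1.
  rewrite /hermite_norm expr0 fact0 !mul1r; congr (_^-1).
  rewrite -!powR12_sqrt ?pi_ge0 ?powR_ge0// -powRrM; congr (_ `^ _).
  by field.
elim/ltn_ind: n y => -[_ y|n IH].
  rewrite /hermite_fun -/(hermite_norm 0) E0 /= hornerC mulr1 normrM.
  rewrite (ger0_norm (ltW M0)) (ger0_norm (expR_ge0 _)).
  rewrite ler_piMr ?(ltW M0)// expR_le1 oppr_le0.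
  by rewrite divr_ge0// sqr_ge0.
apply: hermite_fun_sup_step; first exact: IH.
case: n IH => [|n] IH; first by rewrite hermite_fun_odd0 ?normr0 ?ltW.
have := hermite_fun_rec n 0; rewrite mulr0 mul0r sub0r => h.
have le : ladder n <= ladder n.+1 by rewrite ler_sqrt// ler_pM2l// ler_nat.
rewrite (le_trans _ (IH n (leqnSn _) 0))//.
rewrite -(ler_pM2l (ladder_gt0 n.+1)) -{1}(gtr0_norm (ladder_gt0 n.+1)) -normrM h.
by rewrite normrN normrM gtr0_norm ?ladder_gt0// ler_wpM2r.
Qed.

End HermiteSup.

Theorem lemma5 (R : realType) (eps : R) (eps_gt0 : 0 < eps) :
  (forall (n : nat) (x t : R), 0 <= t ->
    hermite_evolution eps n x t =
      cpow (1 +i* (2 * eps * t)) (n%:R / 2)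
      / cpow (1 -i* (2 * eps * t)) (n.+1%:R / 2)
      * cexp (- (t * eps * x ^+ 2 / (1 + 4 * eps ^+ 2 * t ^+ 2))*i)
      * (hermite_fun n (x / Num.sqrt (1 + 4 * eps ^+ 2 * t ^+ 2)))%:C)
  /\
  (forall (n : nat) (x t : R), 0 <= t ->
    `|hermite_evolution eps n x t| <=
      (1 / (pi * (1 + 4 * eps ^+ 2 * t ^+ 2)) `^ (1 / 4))%:C).
Proof.
split=> [n x t t_ge0 | n x t t_ge0]; first exact: evolution_closed_form.
exact: evolution_bound_of_sup (@hermite_fun_sup R n) eps x t.
Qed.
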